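(* For type $B$, let $P_0=P_1=\emptyset$ and, for $r\ge 2$, let $P_r$ be the set of all elements of the Weyl alternation set $\mathcal B_r=\{\sigma\in W_r:\wp(\sigma(\tilde\alpha+\rho)-\rho)>0\}$ of the Lie algebra of type $B_r$ which do not contain a factor of $s_r$. Then the cardinality of $P_r$ is given by the recursive formula \[|P_r|=|P_{r-1}|+|P_{r-2}|+3|P_{r-3}|+|P_{r-4}|\qquad (r\ge 4),\] where $|P_0|=|P_1|=0$, $|P_2|=2$, $|P_3|=3$.
   Context: Type $B_r$ ($\mathfrak{so}_{2r+1}(\mathbb C)$, $r\ge 2$): simple roots $\alpha_i=\varepsilon_i-\varepsilon_{i+1}$ for $1\le i\le r-1$ and $\alpha_r=\varepsilon_r$; positive roots $\Phi^+=\{\varepsilon_i-\varepsilon_j,\varepsilon_i+\varepsilon_j:1\le i<j\le r\}\cup\{\varepsilon_i:1\le i\le r\}$; highest root $\tilde\alpha=\alpha_1+2\alpha_2+\cdots+2\alpha_r$; $\rho=\frac12\sum_{\alpha\in\Phi^+}\alpha$. $s_i$ denotes the simple reflection in $\alpha_i$, and $W_r$ is the Weyl group generated by $s_1,\dots,s_r$. $\wp(\xi)$ is Kostant's partition function: the number of ways $\xi$ may be written as a nonnegative integral sum of positive roots. An element of $W_r$ contains a factor of $s_r$ if $s_r$ occurs in a (equivalently, every) reduced expression for it. The paper computes $P_2=\{1,s_1\}$. *)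

(* Defs.v *)
From HB Require Import structures.
From mathcomp Require Import all_boot all_order all_algebra.
From mathcomp Require Import finmap.
From mathcomp Require Import boolp classical_sets functions cardinality.
From mathcomp Require Import ring lra zify.

Set Implicit Arguments.
Unset Strict Implicit.
Unset Printing Implicit Defensive.

Import Order.TTheory GRing.Theory Num.Theory.

Local Open Scope classical_set_scope.
Local Open Scope ring_scope.

(* Everything lives in the rational form 'cV[rat]_r of the dual of the Cartan
   subalgebra, in the coordinates eps_1, ..., eps_r. Indices start at 0: the
   vector written eps_(i+1) on paper is [eps r i], the simple root alpha_(i+1)
   is [simple_root i], and alpha_r is the one whose index is r.-1. *)

Definition eps (r i : nat) : 'cV[rat]_r := \col_(k < r) (k == i :> nat)%:R.

Definition dot (r : nat) (u v : 'cV[rat]_r) : rat := \sum_(k < r) u k 0 * v k 0.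

Definition simple_root (r : nat) (i : 'I_r) : 'cV[rat]_r :=
  if i.+1 == r then eps r i else eps r i - eps r i.+1.

Definition pos_roots (r : nat) : {fset 'cV[rat]_r} :=
  let e (i : 'I_r) := eps r i in
  ([fset (e i - e j)%R | i in 'I_r, j in 'I_r & ((i : 'I_r) < j)%N]
   `|` [fset (e i + e j)%R | i in 'I_r, j in 'I_r & ((i : 'I_r) < j)%N]
   `|` [fset e i | i in 'I_r])%fset.

Definition highest_root (r : nat) : 'cV[rat]_r :=
  \sum_(i < r) simple_root i *+ (if i == 0%N :> nat then 1 else 2).

Definition rho (r : nat) : 'cV[rat]_r :=
  2^-1 *: \sum_(a : pos_roots r) val a.

(* The matrix of v |-> v - 2 (v, a) / (a, a) a; see [reflectionE]. *)
Definition reflection (r : nat) (a : 'cV[rat]_r) : 'M[rat]_r :=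
  1%:M - (2 / dot a a) *: (a *m a^T).

Lemma reflectionE (r : nat) (a v : 'cV[rat]_r) :
  reflection a *m v = v - (2 * dot v a / dot a a) *: a.
Proof.
rewrite /reflection mulmxBl mul1mx -scalemxAl -mulmxA.
have -> : a^T *m v = (dot v a)%:M.
  apply/matrixP => i j; rewrite !ord1 !mxE eqxx mulr1n.
  by apply: eq_bigr => k _; rewrite !mxE mulrC.
by rewrite mul_mx_scalar scalerA mulrAC.
Qed.

Definition simple_reflection (r : nat) (i : 'I_r) : 'M[rat]_r :=
  reflection (simple_root i).

Definition word_elt (r : nat) (w : seq 'I_r) : 'M[rat]_r :=
  \prod_(i <- w) simple_reflection i.

(* The simple reflections are involutions, so the group they generate is the
   monoid they generate. *)
Definition weyl_group (r : nat) : set 'M[rat]_r :=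
  [set sigma | exists w : seq 'I_r, word_elt w = sigma].
Arguments weyl_group : clear implicits.

Definition reduced_expression (r : nat) (sigma : 'M[rat]_r) (w : seq 'I_r) :=
  word_elt w = sigma /\
  forall w' : seq 'I_r, word_elt w' = sigma -> (size w <= size w')%N.

Definition contains_factor (r : nat) (i : 'I_r) (sigma : 'M[rat]_r) :=
  exists2 w : seq 'I_r, reduced_expression sigma w & i \in w.

(* Multiplicity functions on the positive roots with weighted sum xi. *)
Definition vector_partitions (r : nat) (xi : 'cV[rat]_r) :
    set {ffun pos_roots r -> nat} :=
  [set m | \sum_(a : pos_roots r) val a *+ m a = xi].

(* [fset_set] is only meaningful on finite sets; see
   [vector_partitions_finite]. *)
Definition kostant (r : nat) (xi : 'cV[rat]_r) : nat :=
  #|` fset_set (vector_partitions xi)|%fset.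

Definition alternation_set (r : nat) : set 'M[rat]_r :=
  [set sigma | weyl_group r sigma /\
     (0 < kostant (sigma *m (highest_root r + rho r) - rho r))%N].
Arguments alternation_set : clear implicits.

(* For r >= 2 the index condition says that i is the last index, i.e. s_r. *)
Definition P (r : nat) : set 'M[rat]_r :=
  if (2 <= r)%N then
    [set sigma | alternation_set r sigma /\
       forall i : 'I_r, i.+1 = r -> ~ contains_factor i sigma]
  else set0.
Arguments P : clear implicits.

Lemma finite_set_enum (T : finType) (U : choiceType) (f : T -> U)
    (A : set U) : (forall x, A x -> exists t, f t = x) -> finite_set A.
Proof.
move=> H; apply: (@sub_finite_set _ _ (f @` setT)); last first.
  exact/finite_image/finite_finset.
by move=> x /H [t <-]; exists t.
Qed.

(* Positive roots have value at least 1 under the linear form h below. *)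
Lemma vector_partitions_finite (r : nat) (xi : 'cV[rat]_r) :
  finite_set (vector_partitions xi).
Proof.
pose h (v : 'cV[rat]_r) : rat := \sum_(k < r) (r - k)%:R * v k 0.
have hD u v : h (u + v) = h u + h v.
  by rewrite /h -big_split /=; apply: eq_bigr => k _; rewrite mxE mulrDr.
have hN u : h (- u) = - h u.
  by rewrite /h -sumrN; apply: eq_bigr => k _; rewrite mxE mulrN.
have h0 : h 0 = 0 by rewrite /h big1 // => k _; rewrite mxE mulr0.
have hMn u n : h (u *+ n) = h u *+ n.
  by elim: n => [|n IH]; rewrite ?mulr0n // !mulrS hD IH.
have heps (i : 'I_r) : h (eps r i) = (r - i)%:R.
  rewrite /h (bigD1 i) //= mxE eqxx mulr1 big1 ?addr0 // => k ki.
  by rewrite mxE (negbTE (_ : _ != _ :> nat)) // mulr0.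
have hge1 (a : pos_roots r) : 1 <= h (val a).
  have := valP a; rewrite /= !inE => /orP[/orP[]|].
  - case/imfset2P => i _ [j]; rewrite !inE /= => ij ->.
    rewrite hD hN !heps -natrB; last by lia.
    by rewrite ler1n; have := ltn_ord j; lia.
  - case/imfset2P => i _ [j]; rewrite !inE /= => ij ->.
    by rewrite hD !heps -natrD ler1n; have := ltn_ord j; lia.
  - case/imfsetP => i _ ->.
    by rewrite heps ler1n; have := ltn_ord i; lia.
have [N hN'] : exists N : nat, h xi < N%:R.
  by exists (Num.bound `|h xi|); rewrite (le_lt_trans (ler_norm _)) // archi_boundP.
apply: (@finite_set_enum {ffun pos_roots r -> 'I_N} _
  (fun g => [ffun a => val (g a)])) => m Hm.
have lemN a : (m a < N)%N.
  rewrite -(ltr_nat rat); apply: le_lt_trans hN'.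
  have -> : h xi = \sum_(b : pos_roots r) h (val b) *+ m b.
    rewrite -Hm (big_morph h hD h0); by apply: eq_bigr => b _; rewrite hMn.
  rewrite (bigD1 a) //= -[leLHS]addr0 lerD //.
    by rewrite -[leRHS]mulr_natr ler_peMl ?hge1 // ler0n.
  by apply: sumr_ge0 => b _; rewrite mulrn_wge0 // (le_trans ler01) ?hge1.
exists [ffun a => Ordinal (lemN a)].
by apply/ffunP => a; rewrite !ffunE.
Qed.

Lemma dot_eps (r : nat) (i : 'I_r) (v : 'cV[rat]_r) : dot v (eps r i) = v i 0.
Proof.
rewrite /dot (bigD1 i) //= mxE eqxx mulr1 big1 ?addr0 // => k ki.
by rewrite mxE (negbTE (_ : _ != _ :> nat)) // mulr0.
Qed.

Lemma dotBr (r : nat) (u v w : 'cV[rat]_r) : dot u (v - w) = dot u v - dot u w.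
Proof.
by rewrite /dot -sumrB; apply: eq_bigr => k _; rewrite !mxE mulrBr.
Qed.

(* Left multiplication by a simple reflection permutes the coordinates up to
   sign, so the entries of Weyl group elements are in {-1, 0, 1}. *)
Lemma simple_reflection_coord (r : nat) (i : 'I_r) (v : 'cV[rat]_r) (k : 'I_r) :
  exists l : 'I_r, exists b : bool,
    (simple_reflection i *m v) k 0 = (-1) ^+ b * v l 0.
Proof.
rewrite /simple_reflection reflectionE /simple_root.
case: eqVneq => [ir|ir].
  rewrite !dot_eps !mxE eqxx mulr1n; exists k, (k == i); rewrite divr1.
  case: (eqVneq k i) => [->|ki]; rewrite ?eqxx ?mulr1n.
    by rewrite expr1; lra.
  by rewrite (negbTE (_ : (k : nat) != i)) // mulr0 subr0 expr0 mul1r.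
have i1r : (i.+1 < r)%N by have := ltn_ord i; lia.
pose j := Ordinal i1r.
have -> : eps r i.+1 = eps r j by [].
rewrite !dotBr !dot_eps !mxE !eqxx /=.
have -> : (j == i :> nat) = false by rewrite /=; lia.
have -> : (i == j :> nat) = false by rewrite /=; lia.
rewrite /=; have [->|ki] := eqVneq k i.
  exists j, false; rewrite eqxx (_ : (i == i.+1 :> nat) = false); last by lia.
  by rewrite expr0 /= ?mulr1n ?mulr0n; field.
have [->|kj] := eqVneq k j.
  exists i, false; rewrite /= eqxx (_ : (i.+1 == i :> nat) = false); last by lia.
  by rewrite expr0 /= ?mulr1n ?mulr0n; field.
exists k, false; rewrite (negbTE (_ : (k : nat) != i)) //.
by rewrite (negbTE (_ : (k : nat) != j)) // expr0 subr0 mulr0 subr0 mul1r.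
Qed.

Lemma weyl_group_finite (r : nat) : finite_set (weyl_group r).
Proof.
apply: (@finite_set_enum 'M['I_3]_r _
  (map_mx (fun a : 'I_3 => (a%:R - 1) : rat))) => sigma [w <-] {sigma}.
have H k l : exists a : 'I_3, (a%:R - 1 : rat) = word_elt w k l.
  elim: w k l => [|i w IH] k l.
    rewrite /word_elt big_nil mxE; case: (k == l).
      by exists (@Ordinal 3 2 isT).
    by exists (@Ordinal 3 1 isT).
  rewrite /word_elt big_cons -/(word_elt w).
  have [k' [b Hb]] := simple_reflection_coord i (col l (word_elt w)) k.
  have -> : (simple_reflection i * word_elt w) k l =
      (simple_reflection i *m col l (word_elt w)) k 0.
    by rewrite -mulmxE !mxE; apply: eq_bigr => ? _; rewrite !mxE.
  rewrite Hb mxE; have [a <-] := IH k' l.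
  case: b {Hb}; last by exists a; rewrite mul1r.
  by exists (rev_ord a); case: a => [[|[|[|//]]] Ha].
exists (\matrix_(k, l) projT1 (cid (H k l))).
by apply/matrixP => k l; rewrite !mxE; case: cid.
Qed.

Lemma P_finite (r : nat) : finite_set (P r).
Proof.
rewrite /P; case: ifP => _; last exact: finite_set0.
apply: sub_finite_set (weyl_group_finite r) => sigma [] [] //.
Qed.

(* [fset_set] is only meaningful on finite sets; see [P_finite]. *)
Definition card_P (r : nat) : nat := #|` fset_set (P r)|%fset.

(* Main.v *)
Require Import Defs.
From mathcomp Require Import all_boot all_fingroup all_algebra.
From mathcomp Require Import finmap boolp classical_sets cardinality.
From mathcomp Require Import zify ring.

(** An element with no factor s_r is a product of s_1, ..., s_(r-1), which permute
    the coordinates: it is a permutation matrix. Conversely a reduced word of a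
    permutation matrix cannot contain s_r, because taking absolute values of
    entries removes every sign change: deleting the letters s_r from the word
    leaves a word for the same matrix ([norm_word_elt], [no_last_factorP]).

    A vector is a nonnegative integral sum of positive roots iff it is one of
    simple roots, and its coefficient on alpha_k is the sum of its first k
    coordinates. So the partition function is positive iff all prefix sums are
    natural numbers ([kostant_prefix_sum]). With coordinates numbered from 0,
    rho is r - k - 1/2 in position k and the highest root is 1 in positions 0
    and 1 and 0 elsewhere, so for a permutation s the vector to be tested has
    coordinate k - s k + [s k < 2] in position k. Hence |P_r| counts the orderings
    of 0, ..., r-1 in which, at every step, the letters used so far exceed in sum
    the smallest possible sum by at most the number of those among them that are
    0 or 1 ([kostant_perm_mx], [card_P_orderings]).

    Once 0 and 1 are used, this says that the excess is at most 2. A k-set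
    of naturals has excess at most 2 only if it is {0..k-1}, {0..k-2, k},
    {0..k-2, k+1} or {0..k-3, k-1, k}, so the orderings are the paths of a
    four-state automaton whose transitions do not depend on k. Eliminating three
    of the states gives a(m) = a(m-1) + a(m-2) + 3 a(m-3) + a(m-4) for the number
    a(m) of ways to place m remaining consecutive letters
    ([orderings_iota]). The choices made before both 0 and 1 are used give
    |P_r| = 2 a(r-2) + a(r-3) ([orderings_from0]), a combination of shifts
    of a, which satisfies the same recursion. *)

Set Implicit Arguments.
Unset Strict Implicit.
Unset Printing Implicit Defensive.

Import GRing.Theory Num.Theory.

(** * Counting constrained orderings *)

(** [t] is the part of the ordering from position [k] on, and [e] is the slack
    accumulated before it: the number of letters 0 and 1 already used minus the
    excess of the used letters over 0 + 1 + ... + (k-1). The slack has to stay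
    nonnegative, so the test precedes the truncated subtraction. *)
Fixpoint admissible (k e : nat) (t : seq nat) : bool :=
  if t is x :: t' then
    (x <= k + e + (x < 2)) && admissible k.+1 (k + e + (x < 2) - x) t'
  else true.

Definition orderings (k e : nat) (R : seq nat) : nat :=
  count (admissible k e) (permutations R).

Lemma orderings_first (k e : nat) (R : seq nat) : 0 < size R -> uniq R ->
  orderings k e R =
  \sum_(x <- R | x <= k + e + (x < 2))
     orderings k.+1 (k + e + (x < 2) - x) (rem x R).
Proof.
move=> R_gt0 uR; rewrite /orderings (seq.permP (permutationsE R_gt0)).
rewrite count_flatten sumnE !big_map undup_id // [RHS]big_mkcond /=.
apply: eq_bigr => x _; rewrite count_map /preim.
case: ifP => xle; last first.
  by rewrite (eq_count (a2 := pred0)) ?count_pred0 // => t; rewrite /= xle.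
by apply: eq_count => t; rewrite /= xle.
Qed.

(** Letters that are too large for the current slack cannot come first, so the sum
    over first letters runs over the short list [s], however long [s'] is. *)
Lemma orderings_large (k e : nat) (s s' : seq nat) :
  0 < size s + size s' -> uniq (s ++ s') -> (forall x, x \in s' -> k + e < x /\ 1 < x) ->
  orderings k e (s ++ s') =
  \sum_(x <- s | x <= k + e + (x < 2))
     orderings k.+1 (k + e + (x < 2) - x) (rem x (s ++ s')).
Proof.
move=> s_gt0 us Hs'; rewrite orderings_first ?size_cat // big_cat /=.
rewrite [X in _ + X]big_seq_cond [X in _ + X]big1 ?addn0 // => x /andP[/Hs' []].
lia.
Qed.

(* Lists the choices of the first letter, which has to lie in [s0], and decides
   by arithmetic which of them the slack permits. *)
Ltac expand_first s0 s1 :=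
  rewrite (@orderings_large _ _ s0 s1);
  [ rewrite /= !big_cons big_nil /= ?eqxx ?addn0;
    repeat match goal with
    | |- context [if (?a <= ?b)%N then _ else _] =>
        (rewrite (_ : (a <= b)%N = true); [|by lia])
        || (rewrite (_ : (a <= b)%N = false); [|by lia])
    | |- context [if (?a == ?b) then _ else _] =>
        (rewrite (_ : (a == b) = false); [|by lia])
    end
  | by []
  | rewrite /= ?inE ?mem_iota ?iota_uniq; lia
  | move=> x; rewrite ?in_nil ?mem_iota; lia].

(** The next lemmas describe the automaton, from a position where the letters 0
    and 1 are already used. In the states named full, skip1, skip2 and late, at
    position p, the set of used letters is {0..p-1}, {0..p-2, p},
    {0..p-2, p+1} and {0..p-3, p-1, p} respectively, with slack 2, 1, 0 and 0.
    In the last three, [k] is the smallest letter still to be placed. *)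
Lemma orderings_full k m : 1 < k ->
  orderings k 2 (iota k m.+3) =
  orderings k.+1 2 (iota k.+1 m.+2) + orderings k.+1 1 (k :: iota k.+2 m.+1)
  + orderings k.+1 0 (k :: k.+1 :: iota k.+3 m).
Proof.
move=> k1; expand_first [:: k; k.+1; k.+2] (iota k.+3 m).
rewrite addnA; congr (orderings _ _ _ + orderings _ _ _ + orderings _ _ _); lia.
Qed.

Lemma orderings_full2 k : 1 < k ->
  orderings k 2 (iota k 2) = orderings k.+1 2 (iota k.+1 1) + orderings k.+1 1 [:: k].
Proof.
move=> k1; expand_first [:: k; k.+1] (@nil nat).
congr (orderings _ _ _ + orderings _ _ _); lia.
Qed.

Lemma orderings_full1 k : 1 < k -> orderings k 2 (iota k 1) = 1.
Proof. by move=> k1; expand_first [:: k] (@nil nat). Qed.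

Lemma orderings_skip1_nil k : 1 < k -> orderings k.+1 1 [:: k] = 1.
Proof. by move=> k1; expand_first [:: k] (@nil nat). Qed.

Lemma orderings_skip1 k m : 1 < k ->
  orderings k.+1 1 (k :: iota k.+2 m.+1) =
  orderings k.+2 2 (iota k.+2 m.+1) + orderings k.+2 0 (k :: iota k.+3 m).
Proof.
move=> k1; expand_first [:: k; k.+2] (iota k.+3 m).
congr (orderings _ _ _ + orderings _ _ _); lia.
Qed.

Lemma orderings_skip2 k m : 1 < k ->
  orderings k.+1 0 (k :: k.+1 :: iota k.+3 m) =
  orderings k.+2 1 (k.+1 :: iota k.+3 m) + orderings k.+2 0 (k :: iota k.+3 m).
Proof.
move=> k1; expand_first [:: k; k.+1] (iota k.+3 m).
congr (orderings _ _ _ + orderings _ _ _); lia.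
Qed.

Lemma orderings_late k m : 1 < k ->
  orderings k.+2 0 (k :: iota k.+3 m) = orderings k.+3 2 (iota k.+3 m).
Proof.
move=> k1; expand_first [:: k] (iota k.+3 m).
congr (orderings _ _ _); lia.
Qed.

(** The values 1, 1, 2, 6 are those of the recursion started from a(0) = 1 with
    a = 0 at negative arguments. *)
Fixpoint tail_count (m : nat) : nat :=
  match m with
  | 0 => 1 | 1 => 1 | 2 => 2 | 3 => 6
  | (((m0.+1 as m1).+1 as m2).+1 as m3).+1 =>
      tail_count m3 + tail_count m2 + 3 * tail_count m1 + tail_count m0
  end.

Lemma orderings_iota k m : 1 < k -> orderings k 2 (iota k m) = tail_count m.
Proof.
elim/ltn_ind: m k => -[|[|[|[|m]]]] IH k k1 //.
- by rewrite orderings_full1.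
- by rewrite orderings_full2 // orderings_full1 ?orderings_skip1_nil //; lia.
(* With three letters left, skip2 has used up all letters beyond the gap, so the
   skip1 state that follows it is that of [orderings_skip1_nil]. *)
- rewrite orderings_full // orderings_skip1 // orderings_skip2 // orderings_late //.
  rewrite !orderings_skip1_nil ?IH //; lia.
rewrite orderings_full // orderings_skip2 // !orderings_skip1 ?orderings_late ?IH //=; lia.
Qed.

Lemma orderings_from0 m :
  orderings 0 0 (iota 0 m.+3) = 2 * tail_count m.+1 + tail_count m.
Proof.
(* The first letter is 1, then 0 has to follow at once. *)
have orderings_101 n : orderings 1 0 (0 :: iota 2 n) = tail_count n.
  by expand_first [:: 0] (iota 2 n); rewrite -(@orderings_iota 2).
(* The ordering starts with 0, 2, then 1 has to follow at once. *)
have orderings_201 n : orderings 2 0 (1 :: iota 3 n) = tail_count n.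
  by expand_first [:: 1] (iota 3 n); rewrite -(@orderings_iota 3).
expand_first [:: 0; 1] (iota 2 m.+1).
rewrite -[0 + 0 + 1 - 0]/1 -[0 + 0 + 1 - 1]/0 (orderings_101 m.+1).
expand_first [:: 1; 2] (iota 3 m).
rewrite -[1 + 1 + 1 - 1]/2 -[1 + 1 + 0 - 2]/0 (@orderings_iota 2 m.+1) //.
by rewrite (orderings_201 m) mul2n -addnn addnAC.
Qed.

(** * Elements without a factor s_r are permutation matrices *)

Local Open Scope ring_scope.

(** The case distinction for the last root disappears because [eps r r] has no
    coordinate to be 1 at, hence is 0. *)
Lemma simple_rootE (r : nat) (i : 'I_r) : simple_root i = eps r i - eps r i.+1.
Proof.
rewrite /simple_root; case: eqP => // ->.
apply/matrixP => k l; rewrite !mxE (_ : (k == r :> nat) = false) ?subr0 //.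
by have := ltn_ord k; lia.
Qed.

Lemma reflection_entry (r : nat) (a : 'cV[rat]_r) (k l : 'I_r) :
  reflection a k l = (k == l)%:R - 2 / dot a a * (a k 0 * a l 0).
Proof. by rewrite !mxE big_ord1 !mxE. Qed.

Lemma norm_last_reflection (r : nat) (i : 'I_r) (A : 'M[rat]_r) (k l : 'I_r) :
  i.+1 = r -> `|(simple_reflection i *m A) k l| = `|A k l|.
Proof.
move=> ir.
have -> : (simple_reflection i *m A) k l = (simple_reflection i *m col l A) k 0.
  by rewrite !mxE; apply: eq_bigr => j _; rewrite !mxE.
rewrite /simple_reflection reflectionE /simple_root ir eqxx !dot_eps !mxE eqxx.
have [->|ki] := eqVneq k i.
  by rewrite eqxx divr1 mulr1 -normrN; congr `|_|; ring.
by rewrite (_ : (k == i :> nat) = false) ?mulr0 ?subr0 //; apply/negbTE.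
Qed.

Lemma simple_reflection_tperm (r : nat) (i j : 'I_r) :
  j = i.+1 :> nat -> simple_reflection i = tperm_mx i j.
Proof.
move=> ij; apply/matrixP => k l.
have [eij eji] : (i == j :> nat) = false /\ (j == i :> nat) = false by lia.
rewrite /simple_reflection reflection_entry simple_rootE -ij.
have -> : dot (eps r i - eps r j) (eps r i - eps r j) = 2.
  by rewrite dotBr !dot_eps !mxE !eqxx eij eji /=; ring.
rewrite divff // mul1r !mxE -!val_eqE /=.
case: tpermP => [->|->|].
- by rewrite eqxx eij ![(_ == l :> nat)]eq_sym /=; ring.
- by rewrite eqxx eji ![(_ == l :> nat)]eq_sym /=; ring.
- move=> /eqP ki /eqP kj; move: ki kj; rewrite -!val_eqE /= => /negbTE -> /negbTE ->.
  by rewrite subrr mul0r subr0.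
Qed.

Lemma word_elt_cons (r : nat) (i : 'I_r) (w : seq 'I_r) :
  word_elt (i :: w) = simple_reflection i *m word_elt w.
Proof. by rewrite /word_elt big_cons mulmxE. Qed.

Lemma word_elt_cat (r : nat) (w w' : seq 'I_r) :
  word_elt (w ++ w') = word_elt w *m word_elt w'.
Proof. by rewrite /word_elt big_cat mulmxE. Qed.

Lemma non_last_reflection (r : nat) (i : 'I_r) : i.+1 != r ->
  exists j : 'I_r, simple_reflection i = tperm_mx i j.
Proof.
move=> ir; have i1r : (i.+1 < r)%N by have := ltn_ord i; lia.
by exists (Ordinal i1r); apply: simple_reflection_tperm.
Qed.

(** s_r only changes the sign of a row, and the other simple reflections exchange
    two rows, so absolute values are blind to the letters s_r. *)
Lemma norm_word_elt (r : nat) (w : seq 'I_r) (k l : 'I_r) :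
  `|word_elt w k l| = word_elt [seq i : 'I_r <- w | i.+1 != r] k l.
Proof.
elim: w k => [|i w IH] k /=; first by rewrite /word_elt big_nil mxE normr_nat.
rewrite word_elt_cons; case: eqVneq => [ir|ir] /=.
  by rewrite norm_last_reflection.
rewrite word_elt_cons; have [j ->] := non_last_reflection ir.
by rewrite -!row_permE !mxE.
Qed.

Lemma word_elt_perm_mx (r : nat) (w : seq 'I_r) :
  all (fun i : 'I_r => i.+1 != r) w -> exists s : 'S_r, word_elt w = perm_mx s.
Proof.
elim: w => [_|i w IH /= /andP[ir /IH[s sE]]].
  by exists 1%g; rewrite perm_mx1 /word_elt big_nil.
rewrite word_elt_cons sE; have [j ->] := non_last_reflection ir.
by exists (tperm i j * s)%g; rewrite perm_mxM.
Qed.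

(** Adjacent transpositions generate: (i j+1) is the conjugate of (i j) by
    (j j+1). *)
Lemma tperm_mx_word (r : nat) (i j : 'I_r) : (i < j)%N ->
  exists2 w : seq 'I_r, all (fun i : 'I_r => i.+1 != r) w & word_elt w = tperm_mx i j.
Proof.
case: j => j jr /=; elim: j jr => // j IH jr ij; set j1 := Ordinal jr.
have [ji|ji] := eqVneq (j : nat) i.
  exists [:: i] => /=; first by rewrite andbT; lia.
  by rewrite word_elt_cons /word_elt big_nil mulmx1 (@simple_reflection_tperm _ _ j1) //= ji.
have jr' : (j < r)%N by lia.
have [|w wlast wE] := IH jr'; first by lia.
set j0 := Ordinal jr' in wE.
exists ([:: j0] ++ w ++ [:: j0]).
  by rewrite /= all_cat wlast /=; lia.
rewrite !word_elt_cat wE /word_elt !big_seq1 (@simple_reflection_tperm _ j0 j1) //.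
rewrite /tperm_mx -!perm_mxM; congr (perm_mx _).
rewrite (tpermC i j1) -(@tpermJ_tperm _ j0 j1 i) -?val_eqE /=; [|lia|lia].
by rewrite /conjg tpermV (tpermC i) mulgA.
Qed.

Lemma perm_mx_word (r : nat) (s : 'S_r) :
  exists2 w : seq 'I_r, all (fun i : 'I_r => i.+1 != r) w & word_elt w = perm_mx s.
Proof.
have [ts -> {s} dts] := prod_tpermP s.
elim: ts dts => [_|[i j] ts IH /= /andP[ij /IH[w wlast wE]]].
  by exists [::] => //; rewrite /word_elt !big_nil perm_mx1.
have [w' w'last w'E] : exists2 w : seq 'I_r,
    all (fun i : 'I_r => i.+1 != r) w & word_elt w = tperm_mx i j.
  case: (ltngtP i j) => [|ji|/val_inj eij]; first exact: tperm_mx_word.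
    by rewrite /tperm_mx tpermC; exact: tperm_mx_word.
  by rewrite eij /dpair /= eqxx in ij.
exists (w' ++ w); first by rewrite all_cat w'last.
by rewrite word_elt_cat w'E wE big_cons perm_mxM.
Qed.

Lemma reduced_expression_exists (r : nat) (sigma : 'M[rat]_r) :
  weyl_group r sigma -> exists w, reduced_expression sigma w.
Proof.
case=> w wE.
have ex : exists n, `[< exists2 w, word_elt w = sigma & size w = n >].
  by exists (size w); apply/asboolP; exists w.
case: (ex_minnP ex) => n /asboolP[w0 w0E <-] min.
exists w0; split=> // w' w'E; apply: min; apply/asboolP; by exists w'.
Qed.

Lemma no_last_factorP (r : nat) (sigma : 'M[rat]_r) :
  (weyl_group r sigma /\
     forall i : 'I_r, i.+1 = r -> ~ contains_factor i sigma) <->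
  exists s : 'S_r, sigma = perm_mx s.
Proof.
split=> [[W nolast]|[s ->]].
  have [w wred] := reduced_expression_exists W.
  have /word_elt_perm_mx[s sE] : all (fun i : 'I_r => i.+1 != r) w.
    by apply/allP => i iw; apply/eqP => ir; apply: (nolast i ir); exists w.
  by exists s; rewrite -sE; case: wred => ->.
split=> [|i ir [w [wE wmin] iw]].
  by have [w _ wE] := perm_mx_word s; exists w.
(* The entries of a permutation matrix are their own absolute values, so
   erasing the last generator from w gives a shorter word for it. *)
have wE' : word_elt [seq i : 'I_r <- w | i.+1 != r] = perm_mx s.
  apply/matrixP => k l; rewrite -norm_word_elt wE !mxE; exact: normr_nat.
have := wmin _ wE'; rewrite leqNgt size_filter ltn_neqAle count_size andbT.
rewrite -all_count negbK => /allP/(_ i iw) /=; by rewrite ir eqxx.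
Qed.

(** * Kostant's partition function *)

(** Up to the index shift these are the coefficients of [v] on the simple roots,
    by [prefix_sum_simple_roots]. *)
Definition prefix_sum (r j : nat) (v : 'cV[rat]_r) : rat :=
  \sum_(i < r | (i < j)%N) v i 0.

Lemma prefix_sumD (r j : nat) : {morph @prefix_sum r j : u v / u + v}.
Proof. by move=> u v; rewrite -big_split; apply: eq_bigr => i _; rewrite mxE. Qed.

Lemma prefix_sum0 (r j : nat) : @prefix_sum r j 0 = 0.
Proof. by rewrite /prefix_sum big1 // => i _; rewrite mxE. Qed.

Lemma prefix_sumMn (r j n : nat) (v : 'cV[rat]_r) :
  prefix_sum j (v *+ n) = prefix_sum j v *+ n.
Proof.
by elim: n => [|n IH]; rewrite ?mulr0n ?prefix_sum0 // !mulrS prefix_sumD IH.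
Qed.

Lemma prefix_sumN (r j : nat) (v : 'cV[rat]_r) :
  prefix_sum j (- v) = - prefix_sum j v.
Proof. by rewrite /prefix_sum -sumrN; apply: eq_bigr => i _; rewrite mxE. Qed.

Lemma prefix_sum_eps (r j : nat) (i : 'I_r) : prefix_sum j (eps r i) = (i < j)%N%:R.
Proof.
rewrite /prefix_sum big_mkcond (bigD1 i) //= mxE eqxx big1 ?addr0 => [|k ki].
  by case: (i < j)%N.
by rewrite mxE (_ : (k == i :> nat) = false) ?if_same //; apply/negbTE.
Qed.

Lemma prefix_sum_pos_root (r j : nat) (a : 'cV[rat]_r) :
  a \in pos_roots r -> prefix_sum j a \is a Num.nat.
Proof.
rewrite /= !inE => /orP[/orP[]|].
- case/imfset2P => i _ [k]; rewrite !inE /= => ik ->.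
  rewrite prefix_sumD prefix_sumN !prefix_sum_eps -natrB ?natr_nat //.
  by lia.
- case/imfset2P => i _ [k]; rewrite !inE /= => ik ->.
  by rewrite prefix_sumD !prefix_sum_eps rpredD ?natr_nat.
- by case/imfsetP => i _ ->; rewrite prefix_sum_eps natr_nat.
Qed.

Lemma simple_root_pos (r : nat) (i : 'I_r) : simple_root i \in pos_roots r.
Proof.
rewrite /simple_root !inE; case: eqVneq => ir.
  by apply/orP; right; apply/imfsetP; exists i.
have i1r : (i.+1 < r)%N by have := ltn_ord i; lia.
apply/orP; left; apply/orP; left; apply/imfset2P; exists i => //.
by exists (Ordinal i1r); rewrite ?inE /=.
Qed.

Lemma prefix_sumS (r : nat) (v : 'cV[rat]_r) (k : 'I_r) :
  prefix_sum k.+1 v = prefix_sum k v + v k 0.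
Proof.
rewrite /prefix_sum (bigD1 k) //= addrC; congr (_ + _).
by apply: eq_bigl => i; rewrite -val_eqE /=; lia.
Qed.

(** Abel summation: coordinate l receives the coefficient of the l-th simple root
    minus that of its predecessor, a difference of consecutive prefix sums. *)
Lemma prefix_sum_simple_roots (r : nat) (v : 'cV[rat]_r) :
  v = \sum_(k < r) prefix_sum k.+1 v *: simple_root k.
Proof.
apply/matrixP => l c; rewrite ord1 summxE.
under eq_bigr => k _ do rewrite mxE simple_rootE !mxE mulrBr.
rewrite sumrB (bigD1 l) //= eqxx mulr1 big1 ?addr0; last first.
  move=> k kl; rewrite (_ : (l == k :> nat) = false) ?mulr0 //.
  by rewrite eq_sym; apply/negbTE.
suff -> : \sum_(i < r) prefix_sum i.+1 v * (l == i.+1 :> nat)%:R = prefix_sum l v.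
  by rewrite prefix_sumS addrAC subrr add0r.
case l0 : (l : nat) => [|p].
  by rewrite /prefix_sum !big1 // => i _; rewrite mulr0.
have pr : (p < r)%N by have := ltn_ord l; lia.
rewrite (bigD1 (Ordinal pr)) //= eqxx mulr1 big1 ?addr0 // => k.
by rewrite -val_eqE /= => kp; rewrite (_ : (_ == _) = false) ?mulr0 //; lia.
Qed.

Lemma kostant_gt0P (r : nat) (xi : 'cV[rat]_r) :
  (0 < kostant xi)%N <-> exists m, vector_partitions xi m.
Proof.
rewrite /kostant cardfs_gt0; split=> [/fset0Pn[m]|[m mxi]].
  rewrite in_fset_set; last exact: vector_partitions_finite.
  by rewrite inE => ?; exists m.
apply/fset0Pn; exists m; rewrite in_fset_set; last exact: vector_partitions_finite.
by rewrite inE.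
Qed.

(** Prefix sums are additive and natural on positive roots, which makes them natural
    on sums of such roots. Conversely natural prefix sums are the multiplicities of
    a partition that uses simple roots only. *)
Lemma kostant_prefix_sum (r : nat) (xi : 'cV[rat]_r) :
  (0 < kostant xi)%N <-> forall j, prefix_sum j xi \is a Num.nat.
Proof.
rewrite kostant_gt0P; split=> [[m <-] j|xi_nat].
  rewrite (big_morph _ (@prefix_sumD r j) (@prefix_sum0 r j)).
  apply: rpred_sum => a _; rewrite prefix_sumMn rpredMn //.
  by apply: prefix_sum_pos_root; exact: valP.
pose a k : pos_roots r := [` simple_root_pos k]%fset.
pose coef k := Num.truncn (prefix_sum k.+1 xi).
exists [ffun b => \sum_(k < r | a k == b) coef k].
rewrite /vector_partitions /= [RHS]prefix_sum_simple_roots.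
under eq_bigr => b _ do rewrite ffunE -sumrMnr.
rewrite (exchange_big_dep xpredT) //=; apply: eq_bigr => k _.
rewrite (big_pred1 (a k)) => [|b]; last by rewrite eq_sym.
by rewrite -scaler_nat truncnK.
Qed.

(** * The highest root and rho *)

(** The multiplicities 1, 2, 2, ... in the definition of the highest root are the
    prefix sums of the right-hand side. *)
Lemma highest_rootE (r : nat) : (2 <= r)%N -> highest_root r = eps r 0 + eps r 1.
Proof.
move=> r2; have r0 : (0 < r)%N by lia.
rewrite [RHS]prefix_sum_simple_roots; apply: eq_bigr => k _.
rewrite prefix_sumD (@prefix_sum_eps r _ (Ordinal r0)) (@prefix_sum_eps r _ (Ordinal r2)) /=.
by rewrite -scaler_nat -natrD; case: (nat_of_ord k).
Qed.

(** Numbers the r^2 positive roots by all pairs of indices: pairs above the diagonal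
    give differences, pairs below it sums and the diagonal the short roots. *)
Definition pair_root (r : nat) (p : 'I_r * 'I_r) : 'cV[rat]_r :=
  if (p.1 < p.2)%N then eps r p.1 - eps r p.2
  else if (p.2 < p.1)%N then eps r p.1 + eps r p.2 else eps r p.1.

Lemma pos_rootsE (r : nat) : pos_roots r =i [seq pair_root p | p <- enum {: 'I_r * 'I_r}].
Proof.
move=> v; rewrite !inE; apply/idP/mapP => [|[[i j] _ ->]].
  case/orP => [/orP[]|].
  - case/imfset2P => i _ [j]; rewrite !inE /= => ij ->.
    by exists (i, j); rewrite ?mem_enum // /pair_root /= ij.
  - case/imfset2P => i _ [j]; rewrite !inE /= => ij ->.
    exists (j, i); rewrite ?mem_enum // /pair_root /= ij.
    by rewrite ltnNge (ltnW ij) addrC.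
  - by case/imfsetP => i _ ->; exists (i, i); rewrite ?mem_enum // /pair_root /= ltnn.
rewrite /pair_root /=; case: (ltngtP i j) => [ij|ij|/val_inj ->].
- apply/orP; left; apply/orP; left; apply/imfset2P; exists i => //.
  by exists j; rewrite ?inE.
- apply/orP; left; apply/orP; right; apply/imfset2P; exists j => //.
  by exists i; rewrite ?inE //= addrC.
- by apply/orP; right; apply/imfsetP; exists j.
Qed.

(** Integer entries make the comparison of two roots a problem of linear arithmetic. *)
Lemma pair_root_entry (r : nat) (p : 'I_r * 'I_r) (m : 'I_r) :
  pair_root p m 0 =
  ((m == p.1 :> nat)%:Z + (p.2 < p.1)%N%:Z * (m == p.2 :> nat)%:Z
   - (p.1 < p.2)%N%:Z * (m == p.2 :> nat)%:Z)%:~R.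
Proof.
rewrite /pair_root; case: (ltngtP p.1 p.2) => _; rewrite !mxE ?mul1r ?mul0r.
- by rewrite addr0 intrB.
- by rewrite subr0 intrD.
- by rewrite addr0 subr0.
Qed.

Lemma pair_root_inj (r : nat) : injective (@pair_root r).
Proof.
move=> [i j] [k l] E.
suff [ik jl] : i = k :> nat /\ j = l :> nat by rewrite (val_inj ik) (val_inj jl).
have e m := congr1 (fun v : 'cV_r => v m 0) E.
(* Comparing the two roots at the four indices involved is enough. *)
have {E} := (e i, e j, e k, e l); rewrite !pair_root_entry /=.
move=> [[[/intr_inj ei /intr_inj ej] /intr_inj ek] /intr_inj el].
clear e; move: (i : nat) (j : nat) (k : nat) (l : nat) ei ej ek el => {}i {}j {}k {}l.
by case: (ltngtP i j) => ?; case: (ltngtP k l) => ?;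
  rewrite ?mul0r ?mul1r ?addr0 ?subr0 ?eqxx; lia.
Qed.

Lemma sum_ltn_ord (n k : nat) : (\sum_(i < n) (i < k) = minn n k)%N.
Proof.
by elim: n => [|n IH]; rewrite ?big_ord0 ?min0n // big_ord_recr /= IH; lia.
Qed.

Lemma sum_gtn_ord (n k : nat) : (\sum_(i < n) (k < i) = n - k.+1)%N.
Proof.
by elim: n => [|n IH]; rewrite ?big_ord0 ?sub0n // big_ord_recr /= IH; lia.
Qed.

(** In coordinate k, the pairs (k, j) contribute 1 each, r in total; the pairs (i, k)
    contribute 1 for each i > k, where the root is a sum, and -1 for each i < k,
    where it is a difference. That makes r + (r - k - 1) - k, which is then halved. *)
Lemma rho_entry (r : nat) (k : 'I_r) : rho r k 0 = r%:R - k%:R - 2^-1.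
Proof.
rewrite /rho mxE -(@big_seq_fsetE _ _ _ _ _ xpredT id) /=.
rewrite (perm_big [seq pair_root p | p <- enum {: 'I_r * 'I_r}]) /=; last first.
  apply: uniq_perm; first exact: fset_uniq.
    by rewrite (map_inj_uniq (@pair_root_inj r)) enum_uniq.
  exact: pos_rootsE.
rewrite big_map big_enum /= summxE.
under eq_bigr => p _ do rewrite pair_root_entry.
rewrite -rmorph_sum /=.
rewrite -(pair_bigA _ (fun i j : 'I_r => (k == i :> nat)%:Z
  + (j < i)%N%:Z * (k == j :> nat)%:Z - (i < j)%N%:Z * (k == j :> nat)%:Z)) /=.
under eq_bigr => i _.
  rewrite sumrB big_split /= sumr_const card_ord.
  rewrite (bigD1 k) //= [X in _ - X](bigD1 k) //= !eqxx !mulr1.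
  rewrite !big1 ?addr0; first over.
  - by move=> j; rewrite -val_eqE eq_sym /= => /negbTE ->; rewrite mulr0.
  - by move=> j; rewrite -val_eqE eq_sym /= => /negbTE ->; rewrite mulr0.
rewrite sumrB big_split /= sumrMnl (bigD1 k) //= eqxx big1 => [|i]; last first.
  by rewrite -val_eqE eq_sym /= => /negbTE ->.
rewrite -!(big_morph Posz PoszD (erefl _)) sum_ltn_ord sum_gtn_ord.
have -> : (true%:Z + 0) *+ r + (r - k.+1)%N%:Z - (minn r k)%:Z
    = (2 * r%:Z - 2 * k%:Z - 1)%R.
  by have := ltn_ord k; rewrite addr0 -mulr_natl mulr1 natz; lia.
by rewrite !rmorphB !rmorphM /=; field.
Qed.

(** * From Weyl group elements to orderings *)

(** The slack at each step is the partial sum of k - t_k + [t_k < 2]; the truncated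
    subtractions in [admissible] are exact as long as it stays nonnegative. *)
Lemma admissibleP (k e : nat) (t : seq nat) :
  admissible k e t <-> forall j, 0 <= e%:Z +
    \sum_(i < size t | (i < j)%N) ((k + i)%N%:Z - (nth 0 t i)%:Z + (nth 0 t i < 2)%N%:Z).
Proof.
elim: t k e => [|x t IH] k e /=.
  by split=> // _ j; rewrite big_ord0 addr0.
have tail j : \sum_(i < (size t).+1 | (i < j.+1)%N)
      ((k + i)%N%:Z - (nth 0 (x :: t) i)%:Z + (nth 0 (x :: t) i < 2)%N%:Z)
    = k%:Z - x%:Z + (x < 2)%N%:Z + \sum_(i < size t | (i < j)%N)
      ((k.+1 + i)%N%:Z - (nth 0 t i)%:Z + (nth 0 t i < 2)%N%:Z).
  rewrite big_mkcond big_ord_recl /= addn0 [in RHS]big_mkcond; congr (_ + _).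
  by apply: eq_bigr => i _; rewrite ltnS addSnnS.
split=> [/andP[xle /IH t_ok] [|j]|t_ok].
- by rewrite big_pred0.
- rewrite tail; have := t_ok j; lia.
- have xle : (x <= k + e + (x < 2))%N.
    by have := t_ok 1%N; rewrite tail big_pred0 //; lia.
  rewrite xle; apply/IH => j; have := t_ok j.+1; rewrite tail; lia.
Qed.

Lemma perm_mx_mulE (r n : nat) (s : 'S_r) (A : 'M[rat]_(r, n)) i j :
  (perm_mx s *m A) i j = A (s i) j.
Proof. by rewrite -row_permE mxE. Qed.

Lemma perm_mx_inj (n : nat) : injective (@perm_mx rat n).
Proof.
move=> s t st; apply/permP => i; apply/eqP.
have /eqP := congr1 (fun A : 'M_n => A i (t i)) st.
by rewrite !mxE eqxx eqr_nat eqb1.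
Qed.

Definition one_line (r : nat) (s : 'S_r) : seq nat := [seq val (s i) | i <- enum 'I_r].

Lemma one_line_inj (r : nat) : injective (@one_line r).
Proof.
move=> s t /eq_in_map st; apply/permP => i; apply: val_inj; apply: st.
by rewrite mem_enum.
Qed.

Lemma nth_one_line (r : nat) (s : 'S_r) (i : 'I_r) : nth 0%N (one_line s) i = s i.
Proof. by rewrite (nth_map i) ?size_enum_ord ?ltn_ord // nth_ord_enum. Qed.

(** One inclusion suffices, since both lists are duplicate-free of length r!. *)
Lemma one_line_permutations (r : nat) :
  perm_eq [seq one_line s | s <- enum 'S_r] (permutations (iota 0 r)).
Proof.
have u : uniq [seq one_line s | s <- enum 'S_r].
  by rewrite (map_inj_uniq (@one_line_inj r)) enum_uniq.
apply: uniq_perm => //; first exact: permutations_uniq.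
apply: (uniq_min_size u _ _).2 => [_ /mapP[s _ ->]|].
  rewrite mem_permutations; apply: uniq_perm; rewrite ?iota_uniq //.
    by rewrite map_inj_uniq ?enum_uniq // => i j /val_inj/perm_inj.
  move=> x; rewrite mem_iota /=; apply/mapP/idP => [[i _ ->]|xr]; first exact: ltn_ord.
  exists (s^-1 (Ordinal xr))%g; first by rewrite mem_enum.
  by rewrite permKV.
by rewrite size_permutations ?iota_uniq // size_map -cardE card_Sn size_iota.
Qed.

Lemma shifted_weight_entry (r : nat) (s : 'S_r) (k : 'I_r) : (2 <= r)%N ->
  (perm_mx s *m (highest_root r + rho r) - rho r) k 0 =
  (k%:Z - (s k)%:Z + (s k < 2)%N%:Z)%:~R.
Proof.
move=> r2; have [rhok rhosk] := (rho_entry k, rho_entry (s k)).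
move: (rho r) rhok rhosk => v vk vsk.
rewrite mxE perm_mx_mulE highest_rootE // !mxE vk vsk rmorphD rmorphB /=.
have -> : (s k == 0 :> nat)%:R + (s k == 1 :> nat)%:R = (s k < 2)%N%:R :> rat.
  by rewrite -natrD; case: (nat_of_ord (s k)) => [|[|]].
ring.
Qed.

(** The prefix sums are integers here, so the criterion reduces to their signs. *)
Lemma kostant_perm_mx (r : nat) (s : 'S_r) : (2 <= r)%N ->
  (0 < kostant (perm_mx s *m (highest_root r + rho r) - rho r))%N <->
  admissible 0 0 (one_line s).
Proof.
move=> r2; rewrite kostant_prefix_sum admissibleP.
have sz : size (one_line s) = r by rewrite size_map size_enum_ord.
suff E j : (prefix_sum j (perm_mx s *m (highest_root r + rho r) - rho r) \is a Num.nat)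
  = (0 <= 0%N%:Z + \sum_(i < size (one_line s) | (i < j)%N) ((0 + i)%N%:Z
      - (nth 0 (one_line s) i)%:Z + (nth 0 (one_line s) i < 2)%N%:Z)).
  by split=> H j; have := H j; rewrite E.
rewrite sz add0r /prefix_sum.
under eq_bigr => i _ do rewrite shifted_weight_entry // -(nth_one_line s).
by rewrite -rmorph_sum /= natrEint intr_int ler0z.
Qed.

Lemma card_P_orderings (r : nat) : (2 <= r)%N ->
  card_P r = orderings 0 0 (iota 0 r).
Proof.
move=> r2; rewrite /orderings -(seq.permP (one_line_permutations r)) count_map -size_filter.
rewrite -(size_map (@perm_mx rat r)); apply: perm_size; apply: uniq_perm.
- exact: fset_uniq.
- by rewrite (map_inj_uniq (@perm_mx_inj r)) filter_uniq ?enum_uniq.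
move=> sigma; rewrite in_fset_set; last exact: P_finite.
apply/idP/mapP => [|[s]].
  rewrite inE /P r2 /= => -[[W K] nolast].
  have [s sE] := (no_last_factorP sigma).1 (conj W nolast).
  exists s => //; rewrite mem_filter mem_enum andbT /=.
  by apply/kostant_perm_mx => //; rewrite -sE.
rewrite mem_filter /= => /andP[/(kostant_perm_mx _ r2).2 K _ sE].
have [W nolast] := (no_last_factorP sigma).2 (ex_intro _ s sE).
by rewrite inE /P r2 /=; split=> //; split=> //; rewrite sE.
Qed.

Lemma card_P_small (r : nat) : (r < 2)%N -> card_P r = 0%N.
Proof. by move=> r2; rewrite /card_P /P leqNgt r2 /= fset_set0 cardfs0. Qed.

Local Close Scope ring_scope.

Theorem proposition4p10 :
  card_P 0 = 0 /\ card_P 1 = 0 /\ card_P 2 = 2 /\ card_P 3 = 3 /\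
  (forall r : nat, 4 <= r ->
     card_P r = card_P (r - 1) + card_P (r - 2) + 3 * card_P (r - 3)
                + card_P (r - 4)).
Proof.
have card_P2 : card_P 2 = 2 by rewrite card_P_orderings.
have card_P3 m : card_P m.+3 = 2 * tail_count m.+1 + tail_count m.
  by rewrite card_P_orderings ?orderings_from0.
do !split; rewrite ?card_P2 ?card_P3 ?card_P_small //.
case=> [|[|[|[|[|[|[|r]]]]]]] // _; rewrite !subSS !subn0 !card_P3 //.
(* For r = 4, 5, 6 the recursion involves values below r = 3. *)
- by rewrite card_P2 !card_P_small.
- by rewrite card_P2 !card_P_small.
- by rewrite card_P2.
- rewrite /=; lia.
Qed.
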